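(* Let $0<u_0<u_1$ with $[u_0,u_1]\subset I$, let $v_0<v_1$, and let $A=(u_0,v_0)$, $B=(u_1,v_1)$ be two points in geodesic coordinates. Suppose that the angular amplitude $\Delta v=v_1-v_0$ satisfies $$\Delta v\le \Phi(u_1)-\Phi(u_0).$$ Then the unique global minimizer of $\mathcal{R}$ in the class of admissible monotonic curves $\mathcal{C}^m_{0,1}$ is the loxodrome $v\mapsto(u(v),v)$, $v\in[v_0,v_1]$, defined by $$\Phi(u(v))=k(v-v_0)+\Phi(u_0),\qquad k=\frac{\Phi(u_1)-\Phi(u_0)}{\Delta v}.$$
   Context: Let $I\subset\mathbb{R}$ be an open interval and $f:I\to(0,\infty)$ a smooth function. A Riemannian surface is given in geodesic coordinates $(u,v)$ with metric $du^2+f(u)^2dv^2$, and points are identified with their coordinates $(u,v)$. Curves that are graphs $u=u(v)$, $v\in[v_0,v_1]$, have resistance $$\mathcal{R}[u]=\int_{v_0}^{v_1}\frac{f(u(v))^2}{u'(v)^2+f(u(v))^2}\,dv .$$ $\Phi:I\to\mathbb{R}$ denotes an antiderivative of $1/f$, so $\Phi(u_1)-\Phi(u_0)=\int_{u_0}^{u_1}\frac{du}{f(u)}$. $PC^1$ means continuous and piecewise $C^1$ (finitely many corners), and $$\mathcal{C}^m_{0,1}=\{u\in PC^1([v_0,v_1],\mathbb{R}^+): u'\ge 0,\ u(v_0)=u_0,\ u(v_1)=u_1\},$$ where $u'\ge0$ is understood wherever $u'$ exists. *)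

(* Defs.v *)
From Stdlib Require Import Reals.
From Coquelicot Require Import Coquelicot.
Open Scope R_scope.

(* Endpoints in Rbar: the interval may be unbounded. *)
Definition Rbar_open_interval (p q : Rbar) (x : R) : Prop :=
  Rbar_lt p x /\ Rbar_lt x q.

Definition segment (a b x : R) : Prop := a <= x <= b.

Definition smooth_on (D : R -> Prop) (f : R -> R) : Prop :=
  forall (n : nat) (x : R), D x -> ex_derive_n f n x.

Definition antiderivative_on (D : R -> Prop) (Phi g : R -> R) : Prop :=
  forall x, D x -> is_derive Phi x (g x).

(* A function on [a, b] is represented by a total function whose values
   outside [a, b] are irrelevant; D_in and continue_in relative to [a, b]
   are therefore one-sided at a and b. *)
Definition continuous_on_segment (a b : R) (u : R -> R) : Prop :=
  forall x, a <= x <= b -> continue_in u (segment a b) x.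

Definition C1_on_segment (a b : R) (u : R -> R) : Prop :=
  exists d : R -> R,
    (forall x, a <= x <= b -> D_in u d (segment a b) x) /\
    continuous_on_segment a b d.

Definition PC1 (a b : R) (u : R -> R) : Prop :=
  continuous_on_segment a b u /\
  exists (n : nat) (t : nat -> R),
    t 0%nat = a /\ t n = b /\
    (forall i, (i < n)%nat -> t i < t (S i)) /\
    (forall i, (i < n)%nat -> C1_on_segment (t i) (t (S i)) u).

Definition admissible (u0 u1 v0 v1 : R) (u : R -> R) : Prop :=
  PC1 v0 v1 u /\
  (forall v, v0 <= v <= v1 -> 0 < u v) /\
  (forall v, v0 < v < v1 -> ex_derive u v -> 0 <= Derive u v) /\
  u v0 = u0 /\ u v1 = u1.

(* Derive is total: for u in PC1 its values at v0, v1 and the corners are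
   unspecified, which does not affect the integral. *)
Definition resistance (f : R -> R) (v0 v1 : R) (u : R -> R) : R :=
  RInt (fun v => f (u v) ^ 2 / (Derive u v ^ 2 + f (u v) ^ 2)) v0 v1.

Definition global_minimizer (K : (R -> R) -> Prop) (F : (R -> R) -> R)
    (u : R -> R) : Prop :=
  K u /\ forall w, K w -> F u <= F w.

Definition unique_global_minimizer (v0 v1 : R) (K : (R -> R) -> Prop)
    (F : (R -> R) -> R) (u : R -> R) : Prop :=
  global_minimizer K F u /\
  forall w, global_minimizer K F w -> forall v, v0 <= v <= v1 -> w v = u v.

(* The graph must stay in the domain D of Phi for the equation to make sense. *)
Definition loxodrome (D : R -> Prop) (Phi : R -> R) (u0 u1 v0 v1 : R)
    (u : R -> R) : Prop :=
  forall v, v0 <= v <= v1 ->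
    D (u v) /\
    Phi (u v) = (Phi u1 - Phi u0) / (v1 - v0) * (v - v0) + Phi u0.

(* Main.v *)
Require Import Defs.
From Stdlib Require Import Reals Lra Lia.
From Coquelicot Require Import Coquelicot.
Open Scope R_scope.

(** Along a curve [u], the slope [s = u' / f(u)] is the derivative of
    [Phi o u], and the integrand of the resistance is [g(s)] with
    [g(s) = 1 / (1 + s^2)].  The mean of [s] over [[v0, v1]] is the same number
    [k = (Phi u1 - Phi u0) / (v1 - v0)] for every curve joining the two points,
    and the loxodrome is the curve for which [s] is constantly [k].  The claim
    is therefore a Jensen inequality for [g] at [k].

    The function [g] is not convex on the half-line [s >= 0], but for [k >= 1],
    which is the amplitude hypothesis, its graph lies above its tangent line at
    [k] on the whole half-line ([tangent_line_below]).  Monotonicity of the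
    curve provides [s >= 0].  The tangent line integrates to a boundary term,
    so the resistance accumulated up to [v] minus the integrated tangent
    ([excess]) is nondecreasing in [v]; comparing its end values gives
    [resistance f v0 v1 u >= (v1 - v0) / (1 + k^2)], which is the resistance of
    the loxodrome ([resistance_lower_bound], [loxodrome_admissible]).

    If equality holds, the excess is identically zero, so the tangent
    inequality is an equality at every smooth point.  This forces [s <= k]
    ([tangent_line_contact]), and since the mean of [s] is [k], the function
    [Phi o u] is affine ([resistance_lower_bound_rigid]); as [Phi] is strictly
    increasing, the curve is the loxodrome.

    Curves have corners, so every passage from a pointwise inequality to a
    global one goes through [nondecreasing_piecewise], which needs the sign of
    the derivative only inside the pieces of a subdivision. *)

(** * One-sided continuity on a segment *)

Definition clamp (a b x : R) : R := Rmax a (Rmin x b).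

Lemma clamp_in_segment a b x : a <= b -> a <= clamp a b x <= b.
Proof.
  intros Hab; unfold clamp; split; [apply Rmax_l|].
  apply Rmax_lub; [exact Hab|apply Rmin_r].
Qed.

Lemma clamp_id a b x : a <= x <= b -> clamp a b x = x.
Proof.
  intros [Ha Hb]; unfold clamp.
  rewrite Rmin_left by exact Hb; apply Rmax_right; exact Ha.
Qed.

Lemma clamp_lipschitz a b x y : Rabs (clamp a b y - clamp a b x) <= Rabs (y - x).
Proof.
  unfold clamp, Rmax, Rmin.
  repeat destruct (Rle_dec _ _); apply Rabs_le_between;
    unfold Rabs; destruct (Rcase_abs _); lra.
Qed.

Lemma continuous_eps (h : R -> R) (x : R) :
  continuous h x <->
  (forall eps, 0 < eps -> exists alp, 0 < alp /\
     forall y, Rabs (y - x) < alp -> Rabs (h y - h x) < eps).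
Proof.
  split.
  - intros H eps Heps.
    apply (filterlim_locally h (h x)) with (eps := mkposreal eps Heps) in H.
    destruct H as [alp H].
    exists alp; split; [apply cond_pos|exact H].
  - intros H; apply filterlim_locally; intros eps.
    destruct (H eps (cond_pos eps)) as (alp & Halp & H').
    exists (mkposreal alp Halp); exact H'.
Qed.

(** Precomposing with the retraction onto [[a, b]] turns one-sided continuity
    into continuity on the whole line, where the usual calculus applies. *)
Lemma continuous_clamp a b h : a <= b ->
  continuous_on_segment a b h -> forall x, continuous (fun y => h (clamp a b y)) x.
Proof.
  intros Hab H x; apply continuous_eps; intros eps Heps.
  pose proof (clamp_in_segment a b x Hab) as Hx.
  destruct (H _ Hx eps Heps) as (alp & Halp & H').
  exists alp; split; [exact Halp|]; intros y Hy.
  destruct (Req_dec (clamp a b y) (clamp a b x)) as [E|E].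
  - rewrite E, Rminus_diag, Rabs_R0; exact Heps.
  - apply (H' (clamp a b y)); split.
    + split; [apply clamp_in_segment; exact Hab|congruence].
    + simpl; unfold Rdist.
      eapply Rle_lt_trans; [apply clamp_lipschitz|exact Hy].
Qed.

Lemma continuous_on_segment_of_clamp a b h :
  (forall x, a <= x <= b -> continuous (fun y => h (clamp a b y)) x) ->
  continuous_on_segment a b h.
Proof.
  intros H x Hx eps Heps.
  destruct (proj1 (continuous_eps _ _) (H x Hx) eps Heps) as (alp & Halp & H').
  exists alp; split; [exact Halp|]; intros y [[Hy _] Hd].
  specialize (H' y Hd); simpl in H'.
  rewrite !clamp_id in H' by assumption; exact H'.
Qed.

Lemma continuous_on_subsegment a b c d h :
  c <= a -> b <= d -> continuous_on_segment c d h -> continuous_on_segment a b h.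
Proof.
  intros Hc Hd H x Hx eps Heps.
  assert (Hx' : c <= x <= d) by lra.
  destruct (H x Hx' eps Heps) as (alp & Halp & H').
  exists alp; split; [exact Halp|]; intros y [[Hy Hn] Hy'].
  apply H'; split; [split; [|exact Hn]|exact Hy'].
  destruct Hy; split; lra.
Qed.

Lemma continuous_on_segment_lipschitz a b M h :
  (forall x y, a <= x -> x <= y -> y <= b -> Rabs (h y - h x) <= M * (y - x)) ->
  continuous_on_segment a b h.
Proof.
  intros H x Hx eps Heps.
  assert (HM : 0 < Rabs M + 1) by (pose proof (Rabs_pos M); lra).
  exists (eps / (Rabs M + 1)); split; [apply Rdiv_lt_0_compat; assumption|].
  simpl; unfold Rdist; intros y [[Hy _] Hd].
  assert (Rabs (h y - h x) <= M * Rabs (y - x)) as Hb.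
  { destruct (Rle_dec x y) as [L|L].
    - rewrite (Rabs_pos_eq (y - x)) by lra; apply H; destruct Hy; lra.
    - rewrite Rabs_minus_sym, (Rabs_minus_sym y), (Rabs_pos_eq (x - y)) by lra.
      apply H; destruct Hy; lra. }
  eapply Rle_lt_trans; [exact Hb|].
  apply Rle_lt_trans with ((Rabs M + 1) * Rabs (y - x)).
  - apply Rmult_le_compat_r; [apply Rabs_pos|pose proof (Rle_abs M); lra].
  - apply Rmult_lt_reg_l with (/ (Rabs M + 1)); [apply Rinv_0_lt_compat; exact HM|].
    replace (/ (Rabs M + 1) * ((Rabs M + 1) * Rabs (y - x))) with (Rabs (y - x))
      by (field; lra).
    unfold Rdiv in Hd; lra.
Qed.

Lemma locally_open_segment a b x (P : R -> Prop) :
  a < x < b -> (forall y, a < y < b -> P y) -> locally x P.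
Proof.
  intros Hx H.
  assert (Hd : 0 < Rmin (x - a) (b - x)) by (apply Rmin_pos; lra).
  exists (mkposreal _ Hd); intros y Hy; apply H.
  change (Rabs (y - x) < Rmin (x - a) (b - x)) in Hy.
  pose proof (Rmin_l (x - a) (b - x)); pose proof (Rmin_r (x - a) (b - x)).
  apply Rabs_lt_between in Hy; lra.
Qed.

Lemma is_derive_D_in_interior a b u d x :
  a < x < b -> D_in u d (segment a b) x -> is_derive u x (d x).
Proof.
  intros Hx H; apply is_derive_Reals; intros eps Heps.
  destruct (H eps Heps) as (alp & Halp & H').
  assert (Hd : 0 < Rmin alp (Rmin (x - a) (b - x)))
    by (repeat apply Rmin_pos; lra).
  exists (mkposreal _ Hd); intros h Hh0 Hh; simpl in Hh.
  pose proof (Rmin_l alp (Rmin (x - a) (b - x))).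
  pose proof (Rmin_r alp (Rmin (x - a) (b - x))).
  pose proof (Rmin_l (x - a) (b - x)); pose proof (Rmin_r (x - a) (b - x)).
  assert (Hh' : Rabs h < x - a /\ Rabs h < b - x) by lra.
  destruct Hh' as [Ha Hb]; apply Rabs_lt_between in Ha, Hb.
  specialize (H' (x + h)); simpl in H'; unfold Rdist in H'.
  replace (x + h - x) with h in H' by ring.
  apply H'; split; [split; [split; lra|lra]|lra].
Qed.

(** * Monotonicity from a sign of the derivative off finitely many points *)

Lemma nondecreasing_on_piece a b h :
  a <= b -> continuous_on_segment a b h ->
  (forall x, a < x < b -> exists l, is_derive h x l /\ 0 <= l) ->
  h a <= h b.
Proof.
  intros Hab Hc Hd.
  (* The mean value point may be an endpoint, where [Derive h] is unspecified;
     [Rmax 0] keeps the candidate slope nonnegative there. *)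
  destruct (MVT_gen (fun x => h (clamp a b x)) a b (fun x => Rmax 0 (Derive h x)))
    as (c & _ & E).
  - rewrite Rmin_left, Rmax_right by exact Hab; intros x Hx.
    destruct (Hd x Hx) as (l & Hl & Hl0).
    rewrite (is_derive_unique _ _ _ Hl), Rmax_right by exact Hl0.
    apply is_derive_ext_loc with (2 := Hl).
    apply locally_open_segment with (1 := Hx); intros y Hy.
    rewrite clamp_id by lra; reflexivity.
  - intros x _; apply continuity_pt_filterlim, continuous_clamp; assumption.
  - rewrite !clamp_id in E by lra.
    pose proof (Rmult_le_pos _ (b - a) (Rmax_l 0 (Derive h c))); lra.
Qed.

Lemma subdivision_le n (t : nat -> R) :
  (forall i, (i < n)%nat -> t i < t (S i)) ->
  forall i j, (i <= j)%nat -> (j <= n)%nat -> t i <= t j.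
Proof.
  intros H i j Hij; induction Hij as [|j Hij IH]; intros Hn; [lra|].
  specialize (H j Hn); specialize (IH ltac:(lia)); lra.
Qed.

Lemma nondecreasing_piecewise n (t : nat -> R) h :
  (forall i, (i < n)%nat -> t i < t (S i)) ->
  continuous_on_segment (t 0%nat) (t n) h ->
  (forall i, (i < n)%nat -> forall x, t i < x < t (S i) ->
     exists l, is_derive h x l /\ 0 <= l) ->
  forall x y, t 0%nat <= x -> x <= y -> y <= t n -> h x <= h y.
Proof.
  induction n as [|n IH]; intros Ht Hc Hd x y Hx Hxy Hy.
  - replace y with x by lra; lra.
  - pose proof (subdivision_le _ _ Ht 0 n ltac:(lia) ltac:(lia)) as H0.
    pose proof (Ht n ltac:(lia)) as Hn.
    assert (IH' : forall x y, t 0%nat <= x -> x <= y -> y <= t n -> h x <= h y).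
    { apply IH.
      - intros i Hi; apply Ht; lia.
      - apply continuous_on_subsegment with (3 := Hc); lra.
      - intros i Hi; apply Hd; lia. }
    assert (Hp : forall x y, t n <= x -> x <= y -> y <= t (S n) -> h x <= h y).
    { intros x' y' H1 H2 H3; apply nondecreasing_on_piece; [exact H2| |].
      - apply continuous_on_subsegment with (3 := Hc); lra.
      - intros z Hz; apply (Hd n); [lia|lra]. }
    destruct (Rle_dec y (t n)); [apply IH'; lra|].
    destruct (Rle_dec (t n) x); [apply Hp; lra|].
    apply Rle_trans with (h (t n)); [apply IH'|apply Hp]; lra.
Qed.

(** * The pointwise inequality *)

(** The right side minus the left side is
    [(s - k)^2 (2 k s + k^2 - 1) / ((1 + k^2)^2 (1 + s^2))]; this is where the
    amplitude bound [1 <= k] enters. *)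
Lemma tangent_line_below k s : 1 <= k -> 0 <= s ->
  / (1 + k ^ 2) - 2 * k / (1 + k ^ 2) ^ 2 * (s - k) <= / (1 + s ^ 2).
Proof.
  intros Hk Hs; apply Rminus_le_0.
  replace (_ - _) with
    ((s - k) ^ 2 * (2 * k * s + (k ^ 2 - 1)) / ((1 + k ^ 2) ^ 2 * (1 + s ^ 2)))
    by (field; split; nra).
  apply Rmult_le_pos.
  - apply Rmult_le_pos; [apply pow2_ge_0|nra].
  - apply Rlt_le, Rinv_0_lt_compat, Rmult_lt_0_compat; [apply pow_lt|]; nra.
Qed.

(** For [k = 1] the tangent touches the graph a second time, at [s = 0], so
    contact only yields [s <= k]. *)
Lemma tangent_line_contact k s : 1 <= k -> 0 <= s ->
  / (1 + s ^ 2) = / (1 + k ^ 2) - 2 * k / (1 + k ^ 2) ^ 2 * (s - k) -> s <= k.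
Proof.
  intros Hk Hs E; apply Rminus_diag_eq in E.
  replace (_ - _) with
    ((s - k) ^ 2 * (2 * k * s + (k ^ 2 - 1)) / ((1 + k ^ 2) ^ 2 * (1 + s ^ 2)))
    in E by (field; split; nra).
  apply Rnot_lt_le; intros H.
  enough (0 < (s - k) ^ 2 * (2 * k * s + (k ^ 2 - 1)) / ((1 + k ^ 2) ^ 2 * (1 + s ^ 2)))
    by lra.
  apply Rdiv_lt_0_compat; apply Rmult_lt_0_compat; try apply pow_lt; nra.
Qed.

(** * Monotone curves *)

Definition integrand (f u : R -> R) (v : R) : R :=
  f (u v) ^ 2 / (Derive u v ^ 2 + f (u v) ^ 2).

(** This keeps the curve inside the region where [f] is positive and [Phi] is
    differentiable: admissibility itself only asks for [u > 0]. *)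
Lemma admissible_range u0 u1 v0 v1 u :
  v0 < v1 -> admissible u0 u1 v0 v1 u ->
  forall v, v0 <= v <= v1 -> u0 <= u v <= u1.
Proof.
  intros Hv ((Hc & n & t & Ht0 & Htn & Ht & HC) & _ & Hm & H0 & H1) v Hvv.
  assert (Hmon : forall x y, v0 <= x -> x <= y -> y <= v1 -> u x <= u y).
  { rewrite <- Ht0, <- Htn; apply nondecreasing_piecewise; [exact Ht| |].
    - rewrite Ht0, Htn; exact Hc.
    - intros i Hi x Hx; destruct (HC i Hi) as (d & Hd & _).
      exists (d x).
      assert (Hdx : is_derive u x (d x))
        by (apply is_derive_D_in_interior with (1 := Hx), Hd; lra).
      split; [exact Hdx|].
      rewrite <- (is_derive_unique _ _ _ Hdx); apply Hm; [|exists (d x); exact Hdx].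
      pose proof (subdivision_le _ _ Ht 0 i ltac:(lia) ltac:(lia)).
      pose proof (subdivision_le _ _ Ht (S i) n ltac:(lia) ltac:(lia)); lra. }
  rewrite <- H0, <- H1; split; apply Hmon; lra.
Qed.

(** The integrand extends continuously to a closed [C^1] piece, although
    [Derive] is unspecified at the corners. *)
Lemma integrand_extension f u a b :
  a < b -> C1_on_segment a b u -> continuous_on_segment a b u ->
  (forall v, a <= v <= b -> continuous f (u v) /\ 0 < f (u v)) ->
  exists F : R -> R, (forall x, continuous F x) /\
    forall x, a < x < b -> integrand f u x = F x.
Proof.
  intros Hab (d & Hd & Hdc) Hc Hf.
  set (c := clamp a b).
  exists (fun x => f (u (c x)) ^ 2 / (d (c x) ^ 2 + f (u (c x)) ^ 2)); split.
  - intros x.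
    destruct (Hf (c x)) as [Hfc Hf0]; [apply clamp_in_segment; lra|].
    assert (Cf : continuity_pt (fun y => f (u (c y))) x).
    { apply continuity_pt_filterlim.
      apply (continuous_comp (fun y => u (c y)) f); [|exact Hfc].
      apply continuous_clamp; [lra|exact Hc]. }
    assert (Cd : continuity_pt (fun y => d (c y)) x)
      by (apply continuity_pt_filterlim, continuous_clamp; [lra|exact Hdc]).
    apply continuity_pt_filterlim.
    assert (Sq : forall h, continuity_pt h x -> continuity_pt (fun y => h y ^ 2) x).
    { intros h Hh.
      apply (continuity_pt_mult h (fun y => h y * 1)); [exact Hh|].
      apply (continuity_pt_mult h (fun _ => 1)); [exact Hh|].
      apply continuity_pt_const; intros y z; reflexivity. }
    apply (continuity_pt_div (fun y => f (u (c y)) ^ 2)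
             (fun y => d (c y) ^ 2 + f (u (c y)) ^ 2)).
    + apply Sq, Cf.
    + apply (continuity_pt_plus (fun y => d (c y) ^ 2) (fun y => f (u (c y)) ^ 2));
        apply Sq; assumption.
    + pose proof (pow2_ge_0 (d (c x))); pose proof (pow_lt _ 2 Hf0); lra.
  - intros x Hx; unfold integrand, c; rewrite clamp_id by lra.
    rewrite (is_derive_unique u x (d x)); [reflexivity|].
    apply is_derive_D_in_interior with (1 := Hx), Hd; lra.
Qed.

Lemma ex_RInt_piecewise n (t : nat -> R) (F : R -> R) :
  (forall i, (i < n)%nat -> ex_RInt F (t i) (t (S i))) -> ex_RInt F (t 0%nat) (t n).
Proof.
  induction n as [|n IH]; intros H; [apply ex_RInt_point|].
  apply ex_RInt_Chasles with (t n); [apply IH; intros i Hi|]; apply H; lia.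
Qed.

Lemma integrand_bounds f u v : 0 < f (u v) -> 0 <= integrand f u v <= 1.
Proof.
  intros Hf; unfold integrand.
  pose proof (pow2_ge_0 (Derive u v)); pose proof (pow_lt _ 2 Hf).
  split.
  - apply Rmult_le_pos; [lra|apply Rlt_le, Rinv_0_lt_compat; lra].
  - apply Rle_div_l; lra.
Qed.

(** * Calibration *)

(** The resistance accumulated up to [v], minus its lower bound obtained by
    integrating the tangent line of [s |-> 1 / (1 + s^2)] at [k] along
    [s = u' / f(u)], the derivative of [Phi o u]. *)
Definition excess (f Phi : R -> R) (k v0 : R) (u : R -> R) (v : R) : R :=
  RInt (integrand f u) v0 v -
  (/ (1 + k ^ 2) * (v - v0)
   - 2 * k / (1 + k ^ 2) ^ 2 * (Phi (u v) - Phi (u v0) - k * (v - v0))).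

Lemma continuous_on_segment_Phi Phi u a b :
  a <= b -> continuous_on_segment a b u ->
  (forall v, a <= v <= b -> continuous Phi (u v)) ->
  continuous_on_segment a b (fun v => Phi (u v)).
Proof.
  intros Hab Hc HP; apply continuous_on_segment_of_clamp; intros x Hx.
  apply (continuous_comp (fun y => u (clamp a b y)) Phi).
  - apply continuous_clamp; assumption.
  - apply HP, clamp_in_segment; exact Hab.
Qed.

(** The integrand takes values in [[0, 1]], so its indefinite integral is
    1-Lipschitz; this gives continuity also at the corners of the curve. *)
Lemma continuous_on_segment_excess (f Phi : R -> R) k v0 v1 u :
  (forall v, v0 <= v <= v1 -> 0 < f (u v)) ->
  ex_RInt (integrand f u) v0 v1 ->
  continuous_on_segment v0 v1 (fun v => Phi (u v)) ->
  continuous_on_segment v0 v1 (excess f Phi k v0 u).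
Proof.
  intros Hf HI HP.
  assert (HJ : continuous_on_segment v0 v1 (RInt (integrand f u) v0)).
  { apply continuous_on_segment_lipschitz with 1; intros x y Hx Hxy Hy.
    assert (I0 : ex_RInt (integrand f u) v0 y)
      by (apply (ex_RInt_Chasles_1 (V := R_CompleteNormedModule)) with v1; [lra|exact HI]).
    assert (Ix : ex_RInt (integrand f u) x y)
      by (apply (ex_RInt_Chasles_2 (V := R_CompleteNormedModule)) with v0; [lra|exact I0]).
    rewrite <- (RInt_Chasles (integrand f u) v0 x y); [|
      apply (ex_RInt_Chasles_1 (V := R_CompleteNormedModule)) with y; [lra|exact I0]|exact Ix].
    change (plus ?a ?b) with (a + b).
    rewrite Rplus_minus_l, Rmult_comm; apply abs_RInt_le_const; [lra|exact Ix|].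
    intros v Hv; pose proof (integrand_bounds f u v (Hf v ltac:(lra))).
    rewrite Rabs_pos_eq; lra. }
  intros x Hx; unfold continue_in, excess.
  assert (Hc : forall c, limit1_in (fun _ => c) (D_x (segment v0 v1) x) c x)
    by (intros c; apply (limit_free (fun _ => c) _ x)).
  assert (Hid : limit1_in (fun v => v) (D_x (segment v0 v1) x) x x) by apply lim_x.
  apply (limit_minus (fun v => RInt (integrand f u) v0 v)); [apply HJ, Hx|].
  apply (limit_minus (fun v => _ * (v - v0))).
  - apply (limit_mul (fun _ => _) (fun v => v - v0)); [apply Hc|].
    apply (limit_minus (fun v => v)); [exact Hid|apply Hc].
  - apply (limit_mul (fun _ => _) (fun v => Phi (u v) - Phi (u v0) - k * (v - v0)));
      [apply Hc|].
    apply (limit_minus (fun v => Phi (u v) - Phi (u v0)) (fun v => k * (v - v0))).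
    + apply (limit_minus (fun v => Phi (u v))); [apply HP, Hx|apply Hc].
    + apply (limit_mul (fun _ => k) (fun v => v - v0)); [apply Hc|].
      apply (limit_minus (fun v => v)); [exact Hid|apply Hc].
Qed.

Lemma is_derive_excess (f Phi : R -> R) k v0 v1 u x s :
  v0 < x < v1 -> 0 < f (u x) ->
  ex_RInt (integrand f u) v0 v1 ->
  continuous (integrand f u) x ->
  is_derive Phi (u x) (/ f (u x)) ->
  is_derive u x (s * f (u x)) ->
  is_derive (excess f Phi k v0 u) x
    (/ (1 + s ^ 2) - (/ (1 + k ^ 2) - 2 * k / (1 + k ^ 2) ^ 2 * (s - k))).
Proof.
  intros Hx Hf HI Hc HP Hu.
  assert (DJ : is_derive (RInt (integrand f u) v0) x (integrand f u x)).
  { apply is_derive_RInt with v0; [|exact Hc].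
    apply locally_open_segment with (1 := Hx); intros y Hy.
    apply RInt_correct, (ex_RInt_Chasles_1 (V := R_CompleteNormedModule)) with v1; [lra|exact HI]. }
  assert (DP : is_derive (fun v => Phi (u v)) x s).
  { replace s with (scal (s * f (u x)) (/ f (u x)))
      by (change (s * f (u x) * / f (u x) = s); field; lra).
    apply (is_derive_comp Phi u); assumption. }
  replace (/ (1 + s ^ 2)) with (integrand f u x).
  2:{ unfold integrand; rewrite (is_derive_unique _ _ _ Hu).
      pose proof (pow2_ge_0 s); pose proof (pow_lt _ 2 Hf).
      pose proof (pow2_ge_0 (s * f (u x))).
      field; repeat split; lra. }
  unfold excess.
  apply (is_derive_minus (RInt (integrand f u) v0)); [exact DJ|].
  apply (is_derive_minus (fun v => / (1 + k ^ 2) * (v - v0))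
           (fun v => 2 * k / (1 + k ^ 2) ^ 2 * (Phi (u v) - Phi (u v0) - k * (v - v0)))).
  - auto_derive; [exact I|apply Rmult_1_r].
  - apply (is_derive_scal (fun v => Phi (u v) - Phi (u v0) - k * (v - v0))).
    replace (s - k) with (minus (minus s 0) k)
      by (change (s - 0 - k = s - k); ring).
    apply (is_derive_minus (fun v => Phi (u v) - Phi (u v0))).
    + apply (is_derive_minus (fun v => Phi (u v))); [exact DP|].
      apply (is_derive_const (Phi (u v0))).
    + auto_derive; [exact I|ring].
Qed.

(** The differential content of admissibility, piece by piece; [s] is the
    slope of [Phi o u]. *)
Lemma admissible_pieces (f Phi : R -> R) k u0 u1 v0 v1 u :
  (forall x, u0 <= x <= u1 -> continuous f x /\ 0 < f x) ->
  (forall x, u0 <= x <= u1 -> is_derive Phi x (/ f x)) ->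
  v0 < v1 -> admissible u0 u1 v0 v1 u ->
  ex_RInt (integrand f u) v0 v1 /\
  exists n (t : nat -> R), t 0%nat = v0 /\ t n = v1 /\
    (forall i, (i < n)%nat -> t i < t (S i)) /\
    forall i, (i < n)%nat -> forall x, t i < x < t (S i) ->
      v0 < x < v1 /\
      exists s, 0 <= s /\ is_derive (fun v => Phi (u v)) x s /\
        is_derive (excess f Phi k v0 u) x
          (/ (1 + s ^ 2) - (/ (1 + k ^ 2) - 2 * k / (1 + k ^ 2) ^ 2 * (s - k))).
Proof.
  intros Hf HP Hv Hu.
  pose proof (admissible_range _ _ _ _ _ Hv Hu) as Hr.
  destruct Hu as ((Hc & n & t & Ht0 & Htn & Ht & HC) & _ & Hm & H0 & H1).
  assert (Hsub : forall i, (i < n)%nat -> v0 <= t i /\ t (S i) <= v1).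
  { intros i Hi; rewrite <- Ht0, <- Htn.
    split; apply (subdivision_le n t Ht); lia. }
  assert (HF : forall i, (i < n)%nat -> exists F : R -> R, (forall x, continuous F x) /\
            forall x, t i < x < t (S i) -> integrand f u x = F x).
  { intros i Hi; destruct (Hsub i Hi).
    apply integrand_extension; [apply Ht, Hi|apply HC, Hi| |].
    - apply continuous_on_subsegment with (3 := Hc); assumption.
    - intros v Hvv; apply Hf, Hr; lra. }
  assert (HI : ex_RInt (integrand f u) v0 v1).
  { rewrite <- Ht0, <- Htn; apply ex_RInt_piecewise; intros i Hi.
    destruct (HF i Hi) as (F & HFc & HFe); specialize (Ht i Hi).
    apply ex_RInt_ext with F.
    - rewrite Rmin_left, Rmax_right by lra; intros x Hx; symmetry; apply HFe, Hx.
    - apply (ex_RInt_continuous (V := R_CompleteNormedModule)); intros z _; apply HFc. }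
  split; [exact HI|].
  exists n, t; split; [exact Ht0|split; [exact Htn|split; [exact Ht|]]].
  intros i Hi x Hx.
  destruct (Hsub i Hi) as [Hl Hr'].
  assert (Hxv : v0 < x < v1) by lra.
  split; [exact Hxv|].
  destruct (HC i Hi) as (d & Hd & _).
  assert (Hdx : is_derive u x (d x))
    by (apply is_derive_D_in_interior with (1 := Hx), Hd; lra).
  assert (Hd0 : 0 <= d x).
  { rewrite <- (is_derive_unique _ _ _ Hdx); apply Hm; [exact Hxv|].
    exists (d x); exact Hdx. }
  assert (Hux : u0 <= u x <= u1) by (apply Hr; lra).
  destruct (Hf _ Hux) as [_ Hf0].
  exists (d x / f (u x)); split; [|split].
  - apply Rmult_le_pos; [exact Hd0|apply Rlt_le, Rinv_0_lt_compat, Hf0].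
  - apply (is_derive_comp Phi u x (/ f (u x)) (d x)); [apply HP, Hux|exact Hdx].
  - apply is_derive_excess with v1; try assumption.
    + destruct (HF i Hi) as (F & HFc & HFe).
      apply continuous_ext_loc with F; [|apply HFc].
      apply locally_open_segment with (1 := Hx); intros y Hy; symmetry; apply HFe, Hy.
    + apply HP, Hux.
    + replace (d x / f (u x) * f (u x)) with (d x) by (field; lra); exact Hdx.
Qed.

(** The boundary term of the tangent line vanishes because [k] is the mean
    slope. *)
Lemma excess_endpoints (f Phi : R -> R) k u v0 v1 :
  Phi (u v1) - Phi (u v0) = k * (v1 - v0) ->
  excess f Phi k v0 u v0 = 0 /\
  excess f Phi k v0 u v1 = resistance f v0 v1 u - (v1 - v0) / (1 + k ^ 2).
Proof.
  intros HD; unfold excess.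
  change (resistance f v0 v1 u) with (RInt (integrand f u) v0 v1).
  rewrite RInt_point; change (@zero _) with 0; rewrite HD.
  unfold Rdiv; split; ring.
Qed.

Lemma continuous_Phi_curve (f Phi : R -> R) u0 u1 v0 v1 u :
  (forall x, u0 <= x <= u1 -> is_derive Phi x (/ f x)) ->
  v0 < v1 -> admissible u0 u1 v0 v1 u ->
  continuous_on_segment v0 v1 (fun v => Phi (u v)).
Proof.
  intros HP Hv Hu.
  pose proof (admissible_range _ _ _ _ _ Hv Hu) as Hr.
  apply continuous_on_segment_Phi; [lra|apply Hu|].
  intros v Hvv; apply (ex_derive_continuous Phi); exists (/ f (u v)); apply HP, Hr, Hvv.
Qed.

Lemma excess_nondecreasing (f Phi : R -> R) k u0 u1 v0 v1 u :
  (forall x, u0 <= x <= u1 -> continuous f x /\ 0 < f x) ->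
  (forall x, u0 <= x <= u1 -> is_derive Phi x (/ f x)) ->
  1 <= k -> v0 < v1 -> admissible u0 u1 v0 v1 u ->
  forall x y, v0 <= x -> x <= y -> y <= v1 ->
    excess f Phi k v0 u x <= excess f Phi k v0 u y.
Proof.
  intros Hf HP Hk Hv Hu.
  destruct (admissible_pieces f Phi k u0 u1 v0 v1 u Hf HP Hv Hu)
    as (HI & n & t & Ht0 & Htn & Ht & Hp).
  rewrite <- Ht0, <- Htn; apply nondecreasing_piecewise.
  - exact Ht.
  - rewrite Ht0, Htn; apply continuous_on_segment_excess.
    + intros v Hvv; apply Hf, (admissible_range _ _ _ _ _ Hv Hu), Hvv.
    + exact HI.
    + apply continuous_Phi_curve with (1 := HP); assumption.
  - intros i Hi x Hx; destruct (Hp i Hi x Hx) as (_ & s & Hs & _ & HE).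
    rewrite Ht0; eexists; split; [exact HE|].
    pose proof (tangent_line_below k s Hk Hs); lra.
Qed.

Lemma resistance_lower_bound (f Phi : R -> R) k u0 u1 v0 v1 u :
  (forall x, u0 <= x <= u1 -> continuous f x /\ 0 < f x) ->
  (forall x, u0 <= x <= u1 -> is_derive Phi x (/ f x)) ->
  1 <= k -> v0 < v1 -> Phi u1 - Phi u0 = k * (v1 - v0) ->
  admissible u0 u1 v0 v1 u ->
  (v1 - v0) / (1 + k ^ 2) <= resistance f v0 v1 u.
Proof.
  intros Hf HP Hk Hv HD Hu.
  pose proof (excess_nondecreasing f Phi k _ _ _ _ u Hf HP Hk Hv Hu v0 v1
                ltac:(lra) ltac:(lra) ltac:(lra)) as H.
  destruct Hu as (_ & _ & _ & H0 & H1).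
  rewrite <- H0, <- H1 in HD.
  destruct (excess_endpoints f Phi k u v0 v1 HD); lra.
Qed.

(** Equality forces the excess to vanish identically, hence the slope of
    [Phi o u] to be at most its mean [k]; a function that never exceeds its
    mean slope is affine. *)
Lemma resistance_lower_bound_rigid (f Phi : R -> R) k u0 u1 v0 v1 u :
  (forall x, u0 <= x <= u1 -> continuous f x /\ 0 < f x) ->
  (forall x, u0 <= x <= u1 -> is_derive Phi x (/ f x)) ->
  1 <= k -> v0 < v1 -> Phi u1 - Phi u0 = k * (v1 - v0) ->
  admissible u0 u1 v0 v1 u ->
  resistance f v0 v1 u <= (v1 - v0) / (1 + k ^ 2) ->
  forall v, v0 <= v <= v1 -> Phi (u v) = k * (v - v0) + Phi u0.
Proof.
  intros Hf HP Hk Hv HD Hu HR v Hvv.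
  pose proof (excess_nondecreasing f Phi k _ _ _ _ u Hf HP Hk Hv Hu) as Hmon.
  pose proof (continuous_Phi_curve f Phi _ _ _ _ u HP Hv Hu) as HPc.
  destruct (admissible_pieces f Phi k u0 u1 v0 v1 u Hf HP Hv Hu)
    as (_ & n & t & Ht0 & Htn & Ht & Hp).
  destruct Hu as (_ & _ & _ & H0 & H1).
  rewrite <- H0, <- H1 in HD; rewrite <- H0.
  destruct (excess_endpoints f Phi k u v0 v1 HD) as [E0 E1].
  assert (E : forall x, v0 < x < v1 -> excess f Phi k v0 u x = 0).
  { intros x Hx.
    pose proof (Hmon v0 x ltac:(lra) ltac:(lra) ltac:(lra)).
    pose proof (Hmon x v1 ltac:(lra) ltac:(lra) ltac:(lra)); lra. }
  assert (Haff : forall x y, v0 <= x -> x <= y -> y <= v1 ->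
            k * x - Phi (u x) <= k * y - Phi (u y)).
  { rewrite <- Ht0, <- Htn.
    apply (nondecreasing_piecewise n t (fun x => k * x - Phi (u x)) Ht).
    - rewrite Ht0, Htn; intros x Hx.
      apply (limit_minus (fun x => k * x) (fun x => Phi (u x))); [|apply HPc, Hx].
      apply (limit_mul (fun _ => k) (fun x => x)); [|apply lim_x].
      apply (limit_free (fun _ => k) _ x).
    - intros i Hi x Hx; destruct (Hp i Hi x Hx) as (Hxv & s & Hs & HPs & HE).
      exists (k - s); split.
      + apply (is_derive_minus (fun x => k * x) (fun x => Phi (u x))); [|exact HPs].
        auto_derive; [exact I|ring].
      + apply -> Rminus_le_0; apply tangent_line_contact; [exact Hk|exact Hs|].
        apply Rminus_diag_uniq.
        rewrite <- (is_derive_unique _ _ _ HE).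
        rewrite (Derive_ext_loc _ (fun _ => 0)); [apply Derive_const|].
        apply locally_open_segment with (1 := Hxv), E. }
  pose proof (Haff v0 v ltac:(lra) ltac:(lra) ltac:(lra)).
  pose proof (Haff v v1 ltac:(lra) ltac:(lra) ltac:(lra)).
  lra.
Qed.

(** * Primitives of [1 / f] *)

Lemma primitive_increment (D : R -> Prop) (f Phi : R -> R) :
  (forall a b x, D a -> D b -> a <= x <= b -> D x) ->
  antiderivative_on D Phi (fun x => / f x) ->
  forall a b, D a -> D b -> a < b ->
  exists c, a <= c <= b /\ Phi b - Phi a = / f c * (b - a).
Proof.
  intros Hconv HP a b Ha Hb Hab.
  destruct (MVT_gen Phi a b (fun x => / f x)) as (c & Hc & E).
  - rewrite Rmin_left, Rmax_right by lra; intros x Hx.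
    apply HP, (Hconv a b); auto; lra.
  - rewrite Rmin_left, Rmax_right by lra; intros x Hx.
    apply continuity_pt_filterlim, (ex_derive_continuous Phi).
    exists (/ f x); apply HP, (Hconv a b); auto.
  - rewrite Rmin_left, Rmax_right in Hc by lra; exists c; split; assumption.
Qed.

Lemma primitive_increasing (D : R -> Prop) (f Phi : R -> R) :
  (forall a b x, D a -> D b -> a <= x <= b -> D x) ->
  (forall x, D x -> 0 < f x) ->
  antiderivative_on D Phi (fun x => / f x) ->
  forall a b, D a -> D b -> a < b -> Phi a < Phi b.
Proof.
  intros Hconv Hf HP a b Ha Hb Hab.
  destruct (primitive_increment D f Phi Hconv HP a b Ha Hb Hab) as (c & Hc & E).
  assert (Dc : D c) by (apply (Hconv a b); assumption).
  pose proof (Rmult_lt_0_compat _ (b - a) (Rinv_0_lt_compat _ (Hf c Dc))); lra.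
Qed.

(** * The loxodrome *)

Lemma Rbar_open_interval_convex p q a b x :
  Rbar_open_interval p q a -> Rbar_open_interval p q b -> a <= x <= b ->
  Rbar_open_interval p q x.
Proof.
  intros [Ha _] [_ Hb] [Hax Hxb]; split.
  - apply Rbar_lt_le_trans with a; assumption.
  - apply Rbar_le_lt_trans with b; assumption.
Qed.

(** The equation is solved by the intermediate value theorem; both [Phi] and the
    parameter are clamped so that a solution can be picked for every real [v]. *)
Lemma loxodrome_exists (D : R -> Prop) (f Phi : R -> R) u0 u1 v0 v1 :
  (forall x, u0 <= x <= u1 -> D x) -> u0 < u1 -> v0 < v1 ->
  antiderivative_on D Phi (fun x => / f x) -> Phi u0 < Phi u1 ->
  exists u, loxodrome D Phi u0 u1 v0 v1 u.
Proof.
  intros HD Hu Hv HP Hlt.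
  set (P := fun x => Phi (clamp u0 u1 x)).
  assert (HPc : continuity P).
  { intros x; apply continuity_pt_filterlim, continuous_clamp; [lra|].
    apply continuous_on_segment_of_clamp; intros y Hy.
    apply (continuous_comp (clamp u0 u1) Phi).
    - apply (continuous_clamp u0 u1 (fun z => z)); [lra|].
      intros z Hz; apply lim_x.
    - apply (ex_derive_continuous Phi); exists (/ f (clamp u0 u1 y)).
      apply HP, HD, clamp_in_segment; lra. }
  set (tau := fun v => (Phi u1 - Phi u0) / (v1 - v0) * (clamp v0 v1 v - v0) + Phi u0).
  assert (Htau : forall v, Rmin (P u0) (P u1) <= tau v <= Rmax (P u0) (P u1)).
  { intros v; unfold P, tau; rewrite !(clamp_id u0 u1), Rmin_left, Rmax_right by lra.
    pose proof (clamp_in_segment v0 v1 v ltac:(lra)) as Hc.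
    set (k := (Phi u1 - Phi u0) / (v1 - v0)).
    assert (Hk : Phi u1 - Phi u0 = k * (v1 - v0)) by (unfold k; field; lra).
    assert (0 < k) by (apply Rdiv_lt_0_compat; lra).
    nra. }
  exists (fun v => proj1_sig (IVT_gen P u0 u1 (tau v) HPc (Htau v))).
  intros v Hvv; destruct (IVT_gen _ _ _ _ _ _) as (x & Hx & E); simpl.
  rewrite Rmin_left, Rmax_right in Hx by lra.
  split; [apply HD, Hx|].
  unfold P, tau in E; rewrite !clamp_id in E by assumption; exact E.
Qed.

Lemma loxodrome_bounds (D : R -> Prop) Phi u0 u1 v0 v1 u :
  (forall a b, D a -> D b -> a < b -> Phi a < Phi b) ->
  D u0 -> D u1 -> u0 < u1 -> v0 < v1 ->
  loxodrome D Phi u0 u1 v0 v1 u ->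
  (forall v, v0 <= v <= v1 -> u0 <= u v <= u1) /\ u v0 = u0 /\ u v1 = u1.
Proof.
  intros Hmon D0 D1 Hu Hv HL.
  set (k := (Phi u1 - Phi u0) / (v1 - v0)) in *.
  assert (Hk : Phi u1 - Phi u0 = k * (v1 - v0)) by (unfold k; field; lra).
  assert (Hk0 : 0 < k).
  { apply Rdiv_lt_0_compat; [pose proof (Hmon _ _ D0 D1 Hu)|]; lra. }
  assert (Hle : forall a b, D a -> D b -> Phi a <= Phi b -> a <= b).
  { intros a b Da Db H; apply Rnot_lt_le; intros Hlt.
    pose proof (Hmon _ _ Db Da Hlt); lra. }
  assert (Hr : forall v, v0 <= v <= v1 -> u0 <= u v <= u1).
  { intros v Hvv; destruct (HL v Hvv) as [Dv E]; fold k in E.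
    split; apply Hle; auto; nra. }
  split; [exact Hr|].
  destruct (HL v0 ltac:(lra)) as [Da Ea], (HL v1 ltac:(lra)) as [Db Eb].
  fold k in Ea, Eb.
  split; apply Rle_antisym; try apply Hr; try lra; apply Hle; auto; lra.
Qed.

(** The mean value theorem for [Phi] between [u x] and [u y], solved for the
    increment of [u].  Continuity and then one-sided differentiability of the
    loxodrome, endpoints included, both follow from this identity, without the
    inverse function theorem. *)
Lemma loxodrome_increment (D : R -> Prop) (f Phi : R -> R) u0 u1 v0 v1 u :
  (forall a b x, D a -> D b -> a <= x <= b -> D x) ->
  (forall x, D x -> 0 < f x) ->
  antiderivative_on D Phi (fun x => / f x) ->
  loxodrome D Phi u0 u1 v0 v1 u ->
  forall x y, v0 <= x <= v1 -> v0 <= y <= v1 ->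
  exists c, Rmin (u x) (u y) <= c <= Rmax (u x) (u y) /\
    u y - u x = (Phi u1 - Phi u0) / (v1 - v0) * f c * (y - x).
Proof.
  intros Hconv Hf HP HL x y Hx Hy.
  set (k := (Phi u1 - Phi u0) / (v1 - v0)).
  destruct (HL x Hx) as [Dx Ex], (HL y Hy) as [Dy Ey]; fold k in Ex, Ey.
  assert (E : Phi (u y) - Phi (u x) = k * (y - x)) by (rewrite Ex, Ey; ring).
  destruct (Rtotal_order (u x) (u y)) as [H|[H|H]].
  - destruct (primitive_increment D f Phi Hconv HP _ _ Dx Dy H) as (c & Hc & Ec).
    exists c; rewrite Rmin_left, Rmax_right by lra; split; [exact Hc|].
    pose proof (Hf c (Hconv _ _ c Dx Dy Hc)).
    replace (k * f c * (y - x)) with (f c * (k * (y - x))) by ring.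
    rewrite <- E, Ec; field; lra.
  - exists (u x); rewrite H, Rmin_left, Rmax_left by lra; split; [lra|].
    rewrite H in E.
    replace (k * f (u y) * (y - x)) with (f (u y) * (k * (y - x))) by ring.
    rewrite <- E; ring.
  - destruct (primitive_increment D f Phi Hconv HP _ _ Dy Dx H) as (c & Hc & Ec).
    exists c; rewrite Rmin_right, Rmax_left by lra; split; [exact Hc|].
    pose proof (Hf c (Hconv _ _ c Dy Dx Hc)).
    replace (k * f c * (y - x)) with (f c * (k * (y - x))) by ring.
    rewrite <- E.
    replace (Phi (u y) - Phi (u x)) with (- (Phi (u x) - Phi (u y))) by ring.
    rewrite Ec; field; lra.
Qed.

Lemma loxodrome_continuous (D : R -> Prop) (f Phi : R -> R) u0 u1 v0 v1 u :
  (forall a b x, D a -> D b -> a <= x <= b -> D x) ->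
  (forall x, D x -> 0 < f x) ->
  (forall x, D x -> continuous f x) ->
  antiderivative_on D Phi (fun x => / f x) ->
  D u0 -> D u1 -> u0 < u1 -> v0 < v1 ->
  loxodrome D Phi u0 u1 v0 v1 u ->
  continuous_on_segment v0 v1 u.
Proof.
  intros Hconv Hf Hfc HP D0 D1 Hu Hv HL.
  pose proof (primitive_increasing D f Phi Hconv Hf HP) as Hmon.
  destruct (loxodrome_bounds D Phi u0 u1 v0 v1 u Hmon D0 D1 Hu Hv HL) as (Hr & _).
  (* [k * max f] over [[u0, u1]] is a Lipschitz constant for [u]. *)
  destruct (continuity_ab_maj f u0 u1) as (m & Hm & _).
  { lra. }
  { intros c Hc; apply continuity_pt_filterlim, Hfc, (Hconv u0 u1); auto. }
  set (k := (Phi u1 - Phi u0) / (v1 - v0)).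
  assert (Hk0 : 0 < k).
  { apply Rdiv_lt_0_compat; [pose proof (Hmon _ _ D0 D1 Hu)|]; lra. }
  apply continuous_on_segment_lipschitz with (k * f m); intros x y Hx Hxy Hy.
  destruct (loxodrome_increment D f Phi u0 u1 v0 v1 u Hconv Hf HP HL x y)
    as (c & Hc & E); [lra|lra|fold k in E].
  assert (Hcr : u0 <= c <= u1).
  { pose proof (Hr x ltac:(lra)); pose proof (Hr y ltac:(lra)).
    unfold Rmin, Rmax in Hc; destruct (Rle_dec _ _); lra. }
  assert (Hfc0 : 0 < f c) by (apply Hf, (Hconv u0 u1); auto).
  pose proof (Hm c Hcr).
  rewrite E, Rabs_pos_eq.
  - apply Rmult_le_compat_r; [lra|]; apply Rmult_le_compat_l; lra.
  - apply Rmult_le_pos; [apply Rmult_le_pos|]; lra.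
Qed.

Lemma loxodrome_D_in (D : R -> Prop) (f Phi : R -> R) u0 u1 v0 v1 u :
  (forall a b x, D a -> D b -> a <= x <= b -> D x) ->
  (forall x, D x -> 0 < f x) ->
  (forall x, D x -> continuous f x) ->
  antiderivative_on D Phi (fun x => / f x) ->
  loxodrome D Phi u0 u1 v0 v1 u ->
  continuous_on_segment v0 v1 u ->
  forall x, v0 <= x <= v1 ->
  D_in u (fun v => (Phi u1 - Phi u0) / (v1 - v0) * f (u v)) (segment v0 v1) x.
Proof.
  intros Hconv Hf Hfc HP HL Huc x Hx eps Heps.
  set (k := (Phi u1 - Phi u0) / (v1 - v0)).
  assert (Hk1 : 0 < Rabs k + 1) by (pose proof (Rabs_pos k); lra).
  destruct (proj1 (continuous_eps f (u x)) (Hfc _ (proj1 (HL x Hx)))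
              (eps / (Rabs k + 1))) as (del & Hdel & Hdelf).
  { apply Rdiv_lt_0_compat; assumption. }
  destruct (Huc x Hx del Hdel) as (alp & Halp & Hu).
  exists alp; split; [exact Halp|]; intros y [[Hy Hn] Hd].
  specialize (Hu y (conj (conj Hy Hn) Hd)); simpl in Hu, Hd |- *.
  unfold Rdist in Hu, Hd |- *.
  destruct (loxodrome_increment D f Phi u0 u1 v0 v1 u Hconv Hf HP HL x y Hx Hy)
    as (c & Hc & E); fold k in E.
  replace ((u y - u x) / (y - x) - k * f (u x)) with (k * (f c - f (u x)))
    by (rewrite E; field; lra).
  assert (Hcx : Rabs (c - u x) < del).
  { eapply Rle_lt_trans; [|exact Hu].
    unfold Rmin, Rmax in Hc; destruct (Rle_dec _ _);
      unfold Rabs; repeat destruct (Rcase_abs _); lra. }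
  specialize (Hdelf c Hcx).
  rewrite Rabs_mult.
  apply Rle_lt_trans with ((Rabs k + 1) * Rabs (f c - f (u x))).
  - apply Rmult_le_compat_r; [apply Rabs_pos|lra].
  - apply Rmult_lt_reg_l with (/ (Rabs k + 1)); [apply Rinv_0_lt_compat, Hk1|].
    rewrite <- Rmult_assoc, Rinv_l, Rmult_1_l by lra.
    unfold Rdiv in Hdelf; lra.
Qed.

Lemma loxodrome_admissible (D : R -> Prop) (f Phi : R -> R) u0 u1 v0 v1 u :
  (forall a b x, D a -> D b -> a <= x <= b -> D x) ->
  (forall x, D x -> 0 < f x) ->
  (forall x, D x -> continuous f x) ->
  antiderivative_on D Phi (fun x => / f x) ->
  D u0 -> D u1 -> 0 < u0 -> u0 < u1 -> v0 < v1 ->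
  loxodrome D Phi u0 u1 v0 v1 u ->
  admissible u0 u1 v0 v1 u /\
  resistance f v0 v1 u =
    (v1 - v0) / (1 + ((Phi u1 - Phi u0) / (v1 - v0)) ^ 2).
Proof.
  intros Hconv Hf Hfc HP D0 D1 Hu0 Hu Hv HL.
  pose proof (primitive_increasing D f Phi Hconv Hf HP) as Hmon.
  destruct (loxodrome_bounds D Phi u0 u1 v0 v1 u Hmon D0 D1 Hu Hv HL)
    as (Hr & E0 & E1).
  pose proof (loxodrome_continuous D f Phi u0 u1 v0 v1 u
                Hconv Hf Hfc HP D0 D1 Hu Hv HL) as Huc.
  pose proof (loxodrome_D_in D f Phi u0 u1 v0 v1 u Hconv Hf Hfc HP HL Huc) as Hd.
  set (k := (Phi u1 - Phi u0) / (v1 - v0)) in *.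
  assert (Hk0 : 0 < k).
  { apply Rdiv_lt_0_compat; [pose proof (Hmon _ _ D0 D1 Hu)|]; lra. }
  assert (Hder : forall v, v0 < v < v1 -> Derive u v = k * f (u v)).
  { intros v Hvv; apply is_derive_unique.
    apply (is_derive_D_in_interior v0 v1 u (fun v => k * f (u v)) v Hvv).
    apply Hd; lra. }
  assert (Hfu : forall v, v0 <= v <= v1 -> 0 < f (u v)).
  { intros v Hvv; apply Hf, HL, Hvv. }
  split.
  - split; [|split; [|split; [|split; assumption]]].
    + split; [exact Huc|].
      exists 1%nat, (fun i => match i with O => v0 | _ => v1 end).
      split; [reflexivity|split; [reflexivity|split]].
      * intros i Hi; replace i with 0%nat by lia; exact Hv.
      * intros i Hi; replace i with 0%nat by lia.
        exists (fun v => k * f (u v)); split; [exact Hd|].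
        apply continuous_on_segment_of_clamp; intros x Hx.
        apply (continuous_mult (K := R_AbsRing) (fun _ => k));
          [apply continuous_const|].
        apply (continuous_comp (fun y => u (clamp v0 v1 y)) f).
        -- apply continuous_clamp; [lra|exact Huc].
        -- apply Hfc, HL, clamp_in_segment; lra.
    + intros v Hvv; specialize (Hr v Hvv); lra.
    + intros v Hvv _; rewrite Hder by exact Hvv.
      apply Rlt_le, Rmult_lt_0_compat; [exact Hk0|apply Hfu; lra].
  - unfold resistance.
    rewrite (RInt_ext _ (fun _ => / (1 + k ^ 2))).
    + rewrite RInt_const; reflexivity.
    + rewrite Rmin_left, Rmax_right by lra; intros v Hvv.
      rewrite Hder by exact Hvv.
      specialize (Hfu v ltac:(lra)).
      pose proof (pow2_ge_0 k); pose proof (pow_lt _ 2 Hfu).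
      pose proof (pow2_ge_0 (k * f (u v))).
      change (f (u v) ^ 2 / ((k * f (u v)) ^ 2 + f (u v) ^ 2) = / (1 + k ^ 2)).
      field; split; lra.
Qed.

Theorem theorem6p1 (p q : Rbar) (f Phi : R -> R) (u0 u1 v0 v1 : R)
    (f_smooth : smooth_on (Rbar_open_interval p q) f)
    (f_pos : forall x, Rbar_open_interval p q x -> 0 < f x)
    (Phi_prim : antiderivative_on (Rbar_open_interval p q) Phi (fun x => / f x))
    (u0_pos : 0 < u0) (u0_lt_u1 : u0 < u1)
    (u01_in_I : forall x, u0 <= x <= u1 -> Rbar_open_interval p q x)
    (v0_lt_v1 : v0 < v1)
    (amplitude : v1 - v0 <= Phi u1 - Phi u0) :
  (exists u, loxodrome (Rbar_open_interval p q) Phi u0 u1 v0 v1 u) /\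
  (forall u, loxodrome (Rbar_open_interval p q) Phi u0 u1 v0 v1 u ->
     unique_global_minimizer v0 v1 (admissible u0 u1 v0 v1)
       (resistance f v0 v1) u).
Proof.
  pose proof (Rbar_open_interval_convex p q) as Hconv.
  set (D := Rbar_open_interval p q) in *.
  assert (f_cont : forall x, D x -> continuous f x).
  { intros x Dx; apply (ex_derive_continuous f), (f_smooth 1%nat x Dx). }
  assert (D0 : D u0) by (apply u01_in_I; lra).
  assert (D1 : D u1) by (apply u01_in_I; lra).
  pose proof (primitive_increasing D f Phi Hconv f_pos Phi_prim) as Phi_incr.
  split.
  { apply loxodrome_exists with f; auto. }
  intros u Hlox.
  destruct (loxodrome_admissible D f Phi u0 u1 v0 v1 u) as [Hadm Hres]; try assumption.
  assert (f_seg : forall x, u0 <= x <= u1 -> continuous f x /\ 0 < f x) by auto.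
  assert (Phi_seg : forall x, u0 <= x <= u1 -> is_derive Phi x (/ f x)).
  { intros x Hx; apply Phi_prim, u01_in_I, Hx. }
  set (k := (Phi u1 - Phi u0) / (v1 - v0)) in *.
  assert (Hk : 1 <= k) by (apply Rle_div_r; lra).
  assert (HD : Phi u1 - Phi u0 = k * (v1 - v0)) by (unfold k; field; lra).
  split.
  - split; [exact Hadm|]; intros w Hw; rewrite Hres.
    apply resistance_lower_bound with Phi u0 u1; assumption.
  - intros w [Hw Hmin] v Hvv.
    specialize (Hmin u Hadm); rewrite Hres in Hmin.
    pose proof (resistance_lower_bound_rigid f Phi k u0 u1 v0 v1 w f_seg Phi_seg
                  Hk v0_lt_v1 HD Hw Hmin v Hvv) as Ew.
    destruct (Hlox v Hvv) as [Du Eu]; fold k in Eu.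
    assert (Dw : D (w v)).
    { apply u01_in_I, (admissible_range u0 u1 v0 v1 w); assumption. }
    destruct (Rtotal_order (w v) (u v)) as [H|[H|H]]; [|exact H|].
    + pose proof (Phi_incr _ _ Dw Du H); lra.
    + pose proof (Phi_incr _ _ Du Dw H); lra.
Qed.
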